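(* Let $\Bbbk$ be a field and let $P$ be a finite poset with least element $\hat 0$ and set of atoms $S$. Suppose that $S$ forms a crosscut in $P\setminus\{\hat 0\}$, and let $f$ be the crosscut homotopy equivalence from the order complex $\Delta(P\setminus\{\hat 0\})$ to the crosscut complex $\Gamma(P\setminus\{\hat 0\},S)$ described in the context. Then for every $\beta\lessdot\alpha$ in $P$ and every $i\ge1$, the map $f$ induces (by restriction to $\Delta_\alpha$ and to $\Delta_\beta$) isomorphisms $\mathfrak{f}_i:\widetilde H_i(\Delta_\alpha,\Bbbk)\to\widetilde H_i(\Gamma_\alpha,\Bbbk)$ and $\mathfrak{f}_{i-1}:\widetilde H_{i-1}(\Delta_\beta,\Bbbk)\to\widetilde H_{i-1}(\Gamma_\beta,\Bbbk)$ such that the diagram $$\begin{array}{ccc}\widetilde H_i(\Delta_\alpha,\Bbbk)&\xrightarrow{\ \mathfrak{f}_i\ }&\widetilde H_i(\Gamma_\alpha,\Bbbk)\\ {\scriptstyle\varphi}\downarrow&&\downarrow{\scriptstyle\varphi}\\ \widetilde H_{i-1}(\Delta_\beta,\Bbbk)&\xrightarrow{\ \mathfrak{f}_{i-1}\ }&\widetilde H_{i-1}(\Gamma_\beta,\Bbbk)\end{array}$$ commutes, where the left vertical map is the component $\varphi_{i+2}^{\alpha,\beta}$ of the sequence $C_\bullet(P)$ and the right vertical map is the component $\varphi_{i+2}^{\alpha,\beta}$ of the sequence $C_\bullet(P,\Gamma)$.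
   Context: **Conventions.** $\lambda\lessdot\alpha$ means that $\alpha$ covers $\lambda$; $S=\{a\in P:\hat 0\lessdot a\}$. Simplicial complexes may be void (no faces, all reduced homology $0$) or equal to $\{\emptyset\}$ (reduced homology $\Bbbk$ in degree $-1$ only); $\widetilde H$ is reduced simplicial homology. The order complex $\Delta(Q)$ of a poset $Q$ is the complex of finite chains of $Q$. **Crosscut.** A subset $C$ of a poset $Q$ is a crosscut if (1) $C$ is an antichain; (2) for every finite chain $\sigma$ of $Q$ some element of $C$ is comparable to every element of $\sigma$; (3) if $A\subseteq C$ is bounded in $Q$ (has an upper bound or a lower bound in $Q$), then the join $\vee A$ or the meet $\wedge A$ exists in $Q$. The crosscut complex $\Gamma(Q,C)$ consists of all subsets of $C$ that are bounded in $Q$. **The complexes.** For $\alpha\in P$ let $\mathbf{D}_\alpha$ be the complex of all chains (including the empty one) in $(\hat 0,\alpha]$, and let $\Delta_\alpha=\bigcup_{\lambda\lessdot\alpha}\mathbf{D}_\lambda$. For $\lambda\lessdot\alpha$ let $\Delta_{\alpha,\lambda}=\mathbf{D}_\lambda\cap\bigcup_{\beta\lessdot\alpha,\beta\ne\lambda}\mathbf{D}_\beta\subset\Delta_\lambda$. Let $S_\alpha=\{a\in S:a\le\alpha\}$, let $\mathbf{G}_\alpha$ be the full simplex on vertex set $S_\alpha$ (all subsets of $S_\alpha$), let $\Gamma_\alpha=\bigcup_{\lambda\lessdot\alpha}\mathbf{G}_\lambda$, and for $\lambda\lessdot\alpha$ let $\Gamma_{\alpha,\lambda}=\mathbf{G}_\lambda\cap\bigcup_{\beta\lessdot\alpha,\beta\ne\lambda}\mathbf{G}_\beta\subset\Gamma_\lambda$.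 **The maps $\varphi$.** For $C_\bullet(P)$ one sets $C_{j,\alpha}=\widetilde H_{j-2}(\Delta_\alpha,\Bbbk)$. For $j\ge2$ and $\lambda\lessdot\alpha$, the map $\varphi_j^{\alpha,\lambda}:\widetilde H_{j-2}(\Delta_\alpha,\Bbbk)\to\widetilde H_{j-3}(\Delta_\lambda,\Bbbk)$ is the composition of the Mayer–Vietoris connecting homomorphism $\widetilde H_{j-2}(\Delta_\alpha,\Bbbk)\to\widetilde H_{j-3}(\Delta_{\alpha,\lambda},\Bbbk)$ for $\Delta_\alpha=\mathbf{D}_\lambda\cup\bigcup_{\beta\lessdot\alpha,\beta\neq\lambda}\mathbf{D}_\beta$ with the map $\widetilde H_{j-3}(\Delta_{\alpha,\lambda},\Bbbk)\to\widetilde H_{j-3}(\Delta_\lambda,\Bbbk)$ induced by inclusion. The connecting homomorphism sends $[c]$ to $[d(c')]$, where $c=c'+c''$ with $c'$ supported on $\mathbf{D}_\lambda$ and $c''$ on the other part. For $C_\bullet(P,\Gamma)$ the maps $\varphi_j^{\alpha,\lambda}:\widetilde H_{j-2}(\Gamma_\alpha,\Bbbk)\to\widetilde H_{j-3}(\Gamma_\lambda,\Bbbk)$ are defined identically, with $\mathbf{G},\Gamma$ in place of $\mathbf{D},\Delta$. **The map $f$.** Write $Q=P\setminus\{\hat 0\}$. The order-reversing map from the poset of nonempty faces of $\Delta(Q)$ to the poset of nonempty faces of $\Gamma(Q,S)$ given by $\sigma\mapsto\{x\in S: x\le y\text{ for all }y\in\sigma\}$ induces a simplicial map $h$ of barycentric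 subdivisions $\operatorname{sd}\Delta(Q)\to\operatorname{sd}\Gamma(Q,S)$. The map $f$ is $h$ followed and preceded by the identifications of a complex with its barycentric subdivision. On reduced chains it is $f_\sharp=\operatorname{unsd}_\sharp\circ h_\sharp\circ\operatorname{sd}_\sharp$, where $\operatorname{sd}_\sharp$ is the subdivision chain map and $\operatorname{unsd}$ is the simplicial map $\operatorname{sd}\Gamma(Q,S)\to\Gamma(Q,S)$ sending a nonempty face $A\subseteq S$ to its minimum under a fixed total order on $S$ (the induced map in homology is independent of this order). The map $f_\sharp$ carries chains on $\mathbf{D}_\alpha$ to chains on $\mathbf{G}_\alpha$, hence chains on $\Delta_\alpha$ to chains on $\Gamma_\alpha$, for every $\alpha\in P$. *)

(* Defs.v *)
From HB Require Import structures.
From mathcomp Require Import all_boot all_order all_algebra.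

Set Implicit Arguments.
Unset Strict Implicit.
Unset Printing Implicit Defensive.

Import Order.Theory GRing.Theory.
Local Open Scope quotient_scope.
Local Open Scope ring_scope.

(** * Quotient vector spaces

   [ring_quotient] equips [{quot U}] with a Z-module structure only. *)

Section QuotientSpace.
Variables (k : fieldType) (vT : vectType k) (U : {vspace vT}).

Definition quotv := Quotient.quot U.

HB.instance Definition _ := GRing.Zmodule.on quotv.
HB.instance Definition _ := EqQuotient.on quotv.

Lemma quotv_eq (u v : vT) : (\pi_quotv u == \pi_quotv v) = (u - v \in U).
Proof. by rewrite -[LHS]Quotient.idealrBE. Qed.

Lemma pi_quotv_is_zmod_morphism : zmod_morphism (\pi_quotv : vT -> quotv).
Proof. exact: pi_is_zmod_morphism. Qed.

Lemma quotvW (T : quotv -> Prop) : (forall u, T (\pi_quotv u)) -> forall x, T x.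
Proof. exact: quotW. Qed.

Definition scale_quotv (a : k) (x : quotv) : quotv := \pi_quotv (a *: repr x).

Lemma pi_scale_quotv a u : \pi_quotv (a *: u) = scale_quotv a (\pi_quotv u).
Proof.
apply/eqP; rewrite quotv_eq -scalerBr rpredZ //.
by rewrite -quotv_eq reprK.
Qed.

Lemma scale_quotvA a b x :
  scale_quotv a (scale_quotv b x) = scale_quotv (a * b) x.
Proof. by elim/quotvW: x => u; rewrite -!pi_scale_quotv scalerA. Qed.

Lemma scale_quotv1 : left_id 1 scale_quotv.
Proof. by elim/quotvW=> u; rewrite -pi_scale_quotv scale1r. Qed.

Let piB := pi_quotv_is_zmod_morphism.
Let pi0 : \pi_quotv (0 : vT) = 0 :> quotv.
Proof. by rewrite -(subrr 0) piB subrr. Qed.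
Let piN u : \pi_quotv (- u : vT) = - \pi_quotv u :> quotv.
Proof. by rewrite -[- u]sub0r piB pi0 sub0r. Qed.
Let piD u v : \pi_quotv (u + v : vT) = \pi_quotv u + \pi_quotv v :> quotv.
Proof. by rewrite -[v in LHS]opprK piB piN opprK. Qed.

Lemma scale_quotvDr : right_distributive scale_quotv +%R.
Proof.
move=> a; elim/quotvW=> u; elim/quotvW=> v.
by rewrite -piD -!pi_scale_quotv scalerDr piD.
Qed.

Lemma scale_quotvDl x : {morph scale_quotv^~ x : a b / a + b}.
Proof.
by move=> a b; elim/quotvW: x => u; rewrite -!pi_scale_quotv scalerDl piD.
Qed.

HB.instance Definition _ := GRing.Zmodule_isLmodule.Build k quotv
  scale_quotvA scale_quotv1 scale_quotvDr scale_quotvDl.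

Lemma pi_quotv_is_linear : linear (\pi_quotv : vT -> quotv).
Proof. by move=> a u v; rewrite piD pi_scale_quotv. Qed.

End QuotientSpace.

(** * Reduced simplicial homology

   A complex on the vertex set [V] is given by its set of faces, so that [set0]
   is the void complex and [[set set0]] is the complex {∅}.  Chains are
   functions on faces, [{ffun {set V} -> k^o}]; a face [s] is oriented by
   listing its vertices in the order of [enum s].  Everything is graded by the
   number of vertices, i.e. by dimension plus one. *)

Notation chain k V := {ffun {set V} -> k^o}.

Definition is_complex (V : finType) (K : {set {set V}}) :=
  forall s t : {set V}, s \in K -> t \subset s -> t \in K.

Section Chains.
Variables (k : fieldType).
Implicit Types V W : finType.

Definition simplex V (s : {set V}) : chain k V := [ffun t => (t == s)%:R].

Fixpoint inversions V (l : seq V) : nat :=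
  if l is x :: l' then
    count (fun y => enum_rank y < enum_rank x)%N l' + inversions l'
  else 0.

(* The oriented simplex [v_0, ..., v_p], zero if a vertex is repeated. *)
Definition osimplex V (l : seq V) : chain k V :=
  if uniq l then (-1) ^+ inversions l *: simplex [set:: l] else 0.

Definition extend V W (b : {set V} -> chain k W) (c : chain k V) : chain k W :=
  \sum_s (c s : k) *: b s.

Lemma extend_is_linear V W (b : {set V} -> chain k W) : linear (extend b).
Proof.
move=> a c c'; rewrite /extend scaler_sumr -big_split /=.
by apply: eq_bigr => s _; rewrite !ffunE scalerA -scalerDl.
Qed.

HB.instance Definition _ V W (b : {set V} -> chain k W) :=
  GRing.isSemilinear.Build k (chain k V) (chain k W) _ (extend b)
    (GRing.semilinear_linear (extend_is_linear b)).

Definition boundary V : 'End(chain k V) :=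
  linfun (extend (fun s : {set V} =>
    \sum_(v in s) (-1) ^+ index v (enum s) *: simplex (s :\ v))).

Definition pushforward V W (g : V -> W) : 'Hom(chain k V, chain k W) :=
  linfun (extend (fun s => osimplex (map g (enum s)))).

(* [v_0, ..., v_p] |-> the sum over permutations w of v of
   sgn(w) [{w_0}, {w_0, w_1}, ..., {w_0, ..., w_p}] *)
Definition subdivision V : 'Hom(chain k V, chain k {set V}) :=
  linfun (extend (fun s =>
    \sum_(w <- permutations (enum s)) (-1) ^+ inversions w *:
      osimplex [seq [set:: take j.+1 w] | j <- iota 0 (size w)])).

Definition restrict V (K : {set {set V}}) : 'End(chain k V) :=
  linfun (extend (fun s => if s \in K then simplex s else 0)).

Definition chains V (n : nat) (K : {set {set V}}) : {vspace chain k V} :=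
  <<[seq simplex s | s : {set V} in [set s in K | #|s| == n]]>>%VS.

Definition cycles V n (K : {set {set V}}) : {vspace chain k V} :=
  (chains n K :&: lker (boundary V))%VS.

Definition boundaries V n (K : {set {set V}}) : {vspace chain k V} :=
  (boundary V @: chains n.+1 K)%VS.

(* [homology n K] is the reduced homology of [K] in degree n - 1. *)
Definition homology V n (K : {set {set V}}) :=
  quotv (linfun (@vsval _ _ (cycles n K)) @^-1: boundaries n K)%VS.

HB.instance Definition _ V n (K : {set {set V}}) :=
  GRing.Lmodule.on (homology n K).

Definition hclass V n (K : {set {set V}}) (z : subvs_of (cycles n K)) :
  homology n K := \pi_(quotv _) z.

(* The map in homology induced by a map of chains [g]; meaningful when [g]
   carries cycles to cycles and boundaries to boundaries, see [hmapE]. *)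
Definition hmap V W (g : 'Hom(chain k V, chain k W)) n m
    (K : {set {set V}}) (L : {set {set W}}) (x : homology n K) : homology m L :=
  hclass (vsproj (cycles m L) (g (vsval (repr x)))).
Arguments hmap {V W} g {n m K L} x.

(* The Mayer-Vietoris connecting homomorphism of K = K1 ∪ K2: the part c' of
   a cycle is the one on the faces of K1, see [connectingE]. *)
Definition connecting V n (K K1 K2 : {set {set V}}) :
    homology n.+1 K -> homology n (K1 :&: K2) :=
  hmap (boundary V \o restrict K1)%VF.

Lemma extend_simplex V W (b : {set V} -> chain k W) s :
  extend b (simplex s) = b s.
Proof.
rewrite /extend (bigD1 s) //= ffunE eqxx scale1r big1 ?addr0 // => t /negPf.
by rewrite ffunE => ->; rewrite scale0r.
Qed.

Lemma chain_sum V (c : chain k V) : c = \sum_s (c s : k) *: simplex s.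
Proof.
apply/ffunP => s; rewrite sum_ffunE (bigD1 s) //= !ffunE eqxx big1 => [|t].
  by rewrite addr0 [RHS]mulr1.
by rewrite eq_sym !ffunE => /negPf->; rewrite scaler0.
Qed.

Lemma chainsP V n (K : {set {set V}}) (c : chain k V) :
  reflect (forall s, c s != 0 -> s \in K /\ #|s| = n) (c \in chains n K).
Proof.
apply: (iffP idP) => [cK s | cK]; last first.
  rewrite [c]chain_sum; apply: rpred_sum => s _.
  have [->|/cK [sK sn]] := eqVneq (c s) 0; first by rewrite scale0r mem0v.
  by apply/rpredZ/memv_span/imageP; exists s; rewrite // !inE sK sn eqxx.
have [|sN] := boolP (s \in [set t in K | #|t| == n]).
  by rewrite inE => /andP[-> /eqP->].
case/eqP; rewrite (coord_span cK) sum_ffunE big1 // => i _; rewrite ffunE.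
have /imageP[t tK ->] : (in_tuple [seq simplex s
   | s : {set V} in [set s in K | #|s| == n]])`_i \in 
  [seq simplex s | s : {set V} in [set s in K | #|s| == n]].
  by apply: mem_nth; rewrite size_image; apply: ltn_ord.
rewrite ffunE; case: eqP tK => [<-|_ _]; first by rewrite (negPf sN).
by rewrite scaler0.
Qed.

Lemma simplex_chains V n (K : {set {set V}}) s :
  s \in K -> #|s| = n -> simplex s \in chains n K.
Proof.
by move=> sK sn; apply/memv_span/imageP; exists s; rewrite // inE sK sn eqxx.
Qed.

Lemma chains_simplex_ind V W n (K : {set {set V}}) (U : {vspace chain k W})
    (g : 'Hom(chain k V, chain k W)) :
  (forall s, s \in K -> #|s| = n -> g (simplex s) \in U) ->
  {in chains n K, forall c, g c \in U}.
Proof.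
move=> gU c /chainsP cK; rewrite [c]chain_sum linear_sum.
apply: rpred_sum => s _; rewrite linearZ /=.
have [->|/cK [sK sn]] := eqVneq (c s) 0; first by rewrite scale0r mem0v.
by apply: rpredZ; apply: gU.
Qed.

Lemma boundary_simplex V (s : {set V}) : boundary V (simplex s) =
  \sum_(v in s) (-1) ^+ index v (enum s) *: simplex (s :\ v).
Proof. by rewrite lfunE /= extend_simplex. Qed.

Lemma restrictE V (K : {set {set V}}) c s :
  restrict K c s = if s \in K then c s else 0.
Proof.
rewrite lfunE /= /extend sum_ffunE (bigD1 s) //= big1 => [|t].
  by rewrite addr0 ffunE; case: ifP; rewrite ffunE ?eqxx ?scaler0 // [LHS]mulr1.
rewrite eq_sym => /negPf ts; rewrite ffunE.
by case: ifP; rewrite ffunE ?ts scaler0.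
Qed.

Lemma index_enum_D1 V (s : {set V}) u v : u \in s -> v \in s -> u != v ->
  (index v (enum (s :\ u)) + (index u (enum s) < index v (enum s)) =
   index v (enum s))%N.
Proof.
rewrite -[u \in s]mem_enum -[v \in s]mem_enum => us vs uv.
have -> : enum (s :\ u) = [seq x <- enum s | x != u].
  rewrite /enum_mem -filter_predI; apply: eq_filter => x.
  by rewrite /= !inE /=.
elim: (enum s) (enum_uniq s) us vs => //= x l IH /andP[xl ul].
rewrite !inE; case: (eqVneq u x) xl => [<- ul' _|ux _ /= ul'] /=.
  rewrite eq_sym (negPf uv) /= => vl; rewrite addn1; congr (index _ _).+1.
  by apply/all_filterP/allP => y yl; apply: contraNneq ul' => <-.
rewrite /= [v == x]eq_sym.
case: (eqVneq x v) => [//|_ /= vl]; rewrite ltnS addSn; congr _.+1; exact: IH.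
Qed.

Lemma boundary_boundary V (c : chain k V) : boundary V (boundary V c) = 0.
Proof.
suff dd s : boundary V (boundary V (simplex s)) = 0.
  rewrite [c]chain_sum !linear_sum big1 // => s _.
  by rewrite 2!linearZ /= dd scaler0.
pose e u v : k := (-1) ^+ (index u (enum s) + index v (enum (s :\ u))).
pose F u v := e u v *: simplex (s :\ u :\ v) : chain k V.
pose lt u v := (index u (enum s) < index v (enum s))%N.
have FN u v : u \in s -> v \in s -> lt u v -> F u v + F v u = 0.
  move=> us vs ltuv; have uv : u != v by apply: contraTneq ltuv => ->; rewrite /lt ltnn.
  have := index_enum_D1 us vs uv; rewrite -/(lt u v) ltuv => ev.
  have := index_enum_D1 vs us; rewrite eq_sym => /(_ uv).
  rewrite ltnNge (ltnW ltuv) addn0 => eu.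
  rewrite /F !setDDl [[set v] :|: _]setUC -scalerDl /e eu -ev.
  by rewrite addn1 addSn exprS [(index v _ + _)%N]addnC mulN1r addrN scale0r.
have -> : boundary V (boundary V (simplex s)) =
    \sum_(u in s) (\sum_(v in s | lt u v) F u v + \sum_(v in s | lt v u) F u v).
  rewrite boundary_simplex linear_sum; apply: eq_bigr => u us.
  rewrite linearZ /= boundary_simplex scaler_sumr.
  rewrite (bigID (lt u)) /=; congr (_ + _); apply: eq_big => v.
  - rewrite !inE andbAC; case: eqVneq => [->|_] /=; last by rewrite andbC.
    by rewrite /lt ltnn andbF.
  - by move=> _; rewrite scalerA -exprD.
  - rewrite !inE -leqNgt leq_eqVlt; case: eqVneq => [->|vu] /=.
      by rewrite /lt ltnn andbF.
    case vs: (v \in s) => //=; rewrite /lt orbC; case: ltnP => //= _.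
    apply: contraNF vu => /eqP iuv.
    by rewrite -(nth_index u (s := enum s) (x := u)) ?mem_enum // -iuv nth_index ?mem_enum.
  - by move=> _; rewrite scalerA -exprD.
rewrite big_split /= [X in _ + X](exchange_big_dep (mem s)) /=; last first.
  by move=> u v _ /andP[].
rewrite -big_split big1 //= => u us.
rewrite [X in _ + X](eq_bigl (fun v => (v \in s) && lt u v)); last first.
  by move=> v; rewrite us.
by rewrite -big_split big1 // => v /andP[vs ltuv] /=; apply: FN.
Qed.

Lemma boundary_chains V n (K : {set {set V}}) : is_complex K ->
  {in chains n.+1 K, forall c, boundary V c \in chains n K}.
Proof.
move=> Kc; apply: chains_simplex_ind => s sK sn.
rewrite boundary_simplex; apply: rpred_sum => v vs; apply: rpredZ.
apply: simplex_chains; first by apply: Kc sK _; apply: subD1set.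
by apply/eqP; rewrite -eqSS -sn (cardsD1 v s) vs.
Qed.

Lemma hclass_is_linear V n (K : {set {set V}}) : linear (@hclass V n K).
Proof. exact: pi_quotv_is_linear. Qed.

HB.instance Definition _ V n (K : {set {set V}}) :=
  GRing.isSemilinear.Build k (subvs_of (cycles n K)) (homology n K) _
    (@hclass V n K) (GRing.semilinear_linear (@hclass_is_linear V n K)).

Lemma hclassW V n (K : {set {set V}}) (T : homology n K -> Prop) :
  (forall z, T (hclass z)) -> forall x, T x.
Proof. exact: quotvW. Qed.

Lemma hclass_eq V n (K : {set {set V}}) (z z' : subvs_of (cycles n K)) :
  (hclass z == hclass z') = (vsval z - vsval z' \in boundaries n K).
Proof. by rewrite quotv_eq -memv_preim lfunE /=. Qed.

Section InducedMap.
Variables (V W : finType) (g : 'Hom(chain k V, chain k W)) (n m : nat).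
Variables (K : {set {set V}}) (L : {set {set W}}).
Hypothesis gZ : {in cycles n K, forall c, g c \in cycles m L}.
Hypothesis gB : {in boundaries n K, forall c, g c \in boundaries m L}.

Lemma hmapE (z : subvs_of (cycles n K)) :
  hmap g (hclass z) = hclass (vsproj (cycles m L) (g (vsval z))) :> homology m L.
Proof.
apply/eqP; rewrite hclass_eq !vsprojK ?gZ ?subvsP // -linearB; apply: gB.
by rewrite -hclass_eq; apply/eqP; apply: reprK.
Qed.

Lemma hmap_linear : linear (hmap g : homology n K -> homology m L).
Proof.
move=> a; elim/hclassW=> z; elim/hclassW=> z'.
by rewrite -linearP !hmapE -linearP; congr hclass; rewrite !linearP.
Qed.

End InducedMap.

Lemma hmap_incl V n (K L : {set {set V}}) (z : subvs_of (cycles n K)) :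
  K \subset L ->
  hmap \1%VF (hclass z) = hclass (vsproj (cycles n L) (vsval z)).
Proof.
move=> KL.
have chKL m : (chains m K <= chains m L)%VS.
  apply/subvP => c /chainsP cK; apply/chainsP => s /cK[sK ->].
  by rewrite (subsetP KL).
rewrite hmapE ?id_lfunE // => c.
  rewrite id_lfunE; apply: subvP; exact: capvS.
rewrite id_lfunE; apply: subvP; exact: limgS.
Qed.

Section MayerVietoris.
Variables (V : finType) (n : nat) (K K1 K2 : {set {set V}}).
Hypotheses (K1c : is_complex K1) (K2c : is_complex K2).
Hypothesis defK : K = K1 :|: K2.
Implicit Types c : chain k V.

Lemma restrict_id m L c : c \in chains m L -> restrict L c = c.
Proof.
move/chainsP=> cL; apply/ffunP=> s; rewrite restrictE; case: ifP => // /negP sL.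
by apply/eqP; rewrite eq_sym; apply/negPn/negP => /cL[].
Qed.

Lemma restrict_chains m c : c \in chains m K -> restrict K1 c \in chains m K1.
Proof.
move/chainsP=> cK; apply/chainsP=> s; rewrite restrictE.
by case: ifP => [sK1 /cK[]|]; rewrite ?eqxx.
Qed.

Lemma restrictC_chains m c : c \in chains m K -> c - restrict K1 c \in chains m K2.
Proof.
move/chainsP=> cK; apply/chainsP=> s; rewrite !ffunE restrictE.
case: ifP => [_|sK1]; first by rewrite subrr eqxx.
by rewrite subr0 => /cK[]; rewrite defK inE sK1.
Qed.

Lemma restrict_chainsI m c : c \in chains m K2 ->
  restrict K1 c \in chains m (K1 :&: K2).
Proof.
move/chainsP=> cK; apply/chainsP=> s; rewrite restrictE inE.
by case: ifP => [sK1 /cK[]|]; rewrite ?eqxx.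
Qed.

Lemma chainsI m c : c \in chains m K1 -> c \in chains m K2 ->
  c \in chains m (K1 :&: K2).
Proof.
move=> /chainsP c1 /chainsP c2; apply/chainsP=> s s0.
by rewrite inE; have [-> ->] := c1 s s0; have [->] := c2 s s0.
Qed.

Lemma boundary_part c c' c'' : c \in cycles n.+1 K -> c = c' + c'' ->
    c' \in chains n.+1 K1 -> c'' \in chains n.+1 K2 ->
  boundary V c' \in cycles n (K1 :&: K2).
Proof.
rewrite memv_cap memv_ker => /andP[_ /eqP dc] def_c c1 c2.
rewrite memv_cap memv_ker boundary_boundary eqxx andbT chainsI //.
  exact: boundary_chains c1.
have -> : boundary V c' = - boundary V c''.
  by apply/eqP; rewrite -addr_eq0 -linearD /= -def_c dc.
by rewrite rpredN boundary_chains.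
Qed.

Lemma connecting_cycles : {in cycles n.+1 K, forall c,
  (boundary V \o restrict K1)%VF c \in cycles n (K1 :&: K2)}.
Proof.
move=> c cZ; have cC := subvP (capvSl _ _) c cZ.
rewrite comp_lfunE; apply: (boundary_part cZ (esym (subrKC _ _))).
  exact: restrict_chains.
exact: restrictC_chains.
Qed.

Lemma boundaries_part c' c'' : c' + c'' \in boundaries n.+1 K ->
    c' \in chains n.+1 K1 -> c'' \in chains n.+1 K2 ->
  boundary V c' \in boundaries n (K1 :&: K2).
Proof.
move=> /memv_imgP[e eK def_c] c1 c2; set e1 := restrict K1 e.
have e1K := restrict_chains eK; have e2K := restrictC_chains eK.
have : c' - boundary V e1 \in chains n.+1 (K1 :&: K2).
  apply: chainsI; first by rewrite rpredB ?(boundary_chains K1c).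
  have -> : c' - boundary V e1 = boundary V (e - e1) - c''.
    by rewrite linearB /= -def_c [RHS]addrAC addrK.
  by rewrite rpredB ?(boundary_chains K2c).
move/(memv_img (boundary V)); rewrite linearB /= boundary_boundary subr0.
by [].
Qed.

Lemma connecting_boundaries : {in boundaries n.+1 K, forall c,
  (boundary V \o restrict K1)%VF c \in boundaries n (K1 :&: K2)}.
Proof.
move=> c cB; rewrite comp_lfunE.
have cC : c \in chains n.+1 K.
  case/memv_imgP: cB => e eK ->; apply: boundary_chains eK => s t.
  rewrite defK !inE => /orP[sK1|sK2] st; apply/orP.
    by left; apply: K1c st.
  by right; apply: K2c st.
apply: (@boundaries_part _ (c - restrict K1 c)); rewrite ?subrKC //.
  exact: restrict_chains.
exact: restrictC_chains.
Qed.

Lemma connecting_linear : linear (@connecting V n K K1 K2).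
Proof. exact: hmap_linear connecting_cycles connecting_boundaries. Qed.

Lemma connectingE (z : subvs_of (cycles n.+1 K)) c' c'' : vsval z = c' + c'' ->
    c' \in chains n.+1 K1 -> c'' \in chains n.+1 K2 ->
  connecting K1 K2 (hclass z) =
    hclass (vsproj (cycles n (K1 :&: K2)) (boundary V c')).
Proof.
move=> def_z c1 c2; rewrite /connecting (hmapE connecting_cycles connecting_boundaries).
have zZ := subvsP z; have zC := subvP (capvSl _ _) _ zZ.
apply/eqP; rewrite hclass_eq !vsprojK ?connecting_cycles //; last first.
  exact: boundary_part def_z c1 c2.
rewrite comp_lfunE -linearB.
apply: (@boundaries_part _ (vsval z - restrict K1 (vsval z) - c'')).
- by rewrite addrACA -opprD subrKC -def_z subrr mem0v.
- by rewrite rpredB // restrict_chains.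
- by rewrite rpredB // restrictC_chains.
Qed.

End MayerVietoris.

Lemma osimplex_chains V n (K : {set {set V}}) (l : seq V) :
  size l = n -> [set:: l] \in K -> osimplex l \in chains n K.
Proof.
rewrite /osimplex => ln lK; case: ifP => [ul|_]; last exact: mem0v.
apply/rpredZ/simplex_chains => //.
by rewrite cardsE; move/card_uniqP: ul => ->.
Qed.

Lemma pushforward_chains V W (g : V -> W) n
    (K : {set {set V}}) (L : {set {set W}}) :
  (forall s, s \in K -> g @: s \in L) ->
  {in chains n K, forall c, pushforward g c \in chains n L}.
Proof.
move=> gKL; apply: chains_simplex_ind => s sK sn.
rewrite lfunE /= extend_simplex; apply: osimplex_chains.
  by rewrite size_map -cardE.
suff -> : [set:: map g (enum s)] = g @: s by apply: gKL.
by apply/setP=> w; rewrite inE; apply/mapP/imsetP => -[x xs ->]; exists x;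
   rewrite ?mem_enum // -mem_enum.
Qed.

Lemma subdivision_chains V n (K : {set {set V}}) : is_complex K ->
  {in chains n K, forall c, subdivision V c \in chains n (powerset (K :\ set0))}.
Proof.
move=> Kc; apply: chains_simplex_ind => s sK sn.
rewrite lfunE /= extend_simplex big_seq; apply: rpred_sum => w.
rewrite mem_permutations => ws; apply/rpredZ/osimplex_chains.
  by rewrite size_map size_iota (perm_size ws) -cardE.
rewrite powersetE; apply/subsetP => t.
rewrite inE => /mapP[j]; rewrite mem_iota /= => jw ->; rewrite !inE.
apply/andP; split.
  case: w jw {ws} => // x w _; apply/set0Pn; exists x.
  by rewrite inE mem_head.
apply: Kc sK _; apply/subsetP => x; rewrite inE => /mem_take.
by rewrite (perm_mem ws) mem_enum.
Qed.

End Chains.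

Arguments hmap {k V W} g {n m K L} x.
Arguments connecting {k V n K} K1 K2 x.

(* The map of homology [F] is the one induced by the map of chains [g]. *)
Definition induces (k : fieldType) (V W : finType)
    (g : 'Hom(chain k V, chain k W)) n (K : {set {set V}}) (L : {set {set W}})
    (F : homology k n K -> homology k n L) : Prop :=
  forall z : subvs_of (cycles k n K),
    exists2 w : subvs_of (cycles k n L),
      vsval w = g (vsval z) & F (hclass z) = hclass w.

(** * Order complexes and crosscuts

   A subposet is given by a subset [Q] of an ambient finite poset. *)

Section Crosscut.
Variables (d : Order.disp_t) (T : finPOrderType d).
Implicit Types (Q C A : {set T}) (x y : T).

Definition covered_by x y := (x < y)%O && [forall z, ~~ (x < z < y)%O].

Definition order_complex Q : {set {set T}} :=
  [set s : {set T} | s \subset Q &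
     [forall x in s, [forall y in s, (x >=< y)%O]]].

Definition upper_bound A x := [forall a in A, (a <= x)%O].
Definition lower_bound A x := [forall a in A, (x <= a)%O].

Definition is_join Q A x :=
  [/\ x \in Q, upper_bound A x & forall y, y \in Q -> upper_bound A y -> (x <= y)%O].
Definition is_meet Q A x :=
  [/\ x \in Q, lower_bound A x & forall y, y \in Q -> lower_bound A y -> (y <= x)%O].

Definition is_bounded Q A :=
  [exists x in Q, upper_bound A x || lower_bound A x].

(* The last condition is only meant for nonempty A: the join of the empty set
   would be a least element of Q. *)
Definition is_crosscut Q C : Prop :=
  [/\ C \subset Q,
      {in C &, forall x y, (x <= y)%O -> x = y},
      forall s, s \in order_complex Q ->
        exists2 c, c \in C & {in s, forall x, (c >=< x)%O}
    & forall A, A != set0 -> A \subset C -> is_bounded Q A ->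
        exists x, is_join Q A x \/ is_meet Q A x].

Definition crosscut_complex Q C : {set {set T}} :=
  [set A : {set T} | (A \subset C) && is_bounded Q A].

End Crosscut.

Section PosetHomology.
Variables (d : Order.disp_t) (P : finBPOrderType d).
Implicit Types (a b l : P) (X : P -> {set {set P}}).

Definition atoms : {set P} := [set a | covered_by \bot%O a].

Definition Dcomplex a : {set {set P}} :=
  order_complex [set x | (\bot < x <= a)%O].

Definition Gcomplex a : {set {set P}} := powerset [set x in atoms | (x <= a)%O].

(* C(P) and C(P,Γ) are the same construction for two families X of
   complexes indexed by P, namely D and G. *)
Definition covered_union X a := \bigcup_(l | covered_by l a) X l.

Definition other_union X a l := \bigcup_(b | covered_by b a && (b != l)) X b.

Definition Delta a := covered_union Dcomplex a.
Definition Gamma a := covered_union Gcomplex a.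

(* [phi X n a l] has source H_n and target H_(n-1): it is φ_(n+2)^(a,l). *)
Definition phi (k : fieldType) X n a l
    (x : homology k n.+1 (covered_union X a)) :
    homology k n (covered_union X l) :=
  hmap \1%VF (connecting (X l) (other_union X a l) x).

Definition atoms_below (s : {set P}) : {set P} :=
  [set x in atoms | [forall y in s, (x <= y)%O]].

Definition least_elt (r : rel P) (A : {set P}) : P :=
  odflt \bot%O [pick x in A | [forall y in A, r x y]].

(* The map f on chains; [r] is the order on the atoms used to identify
   the crosscut complex with its barycentric subdivision. *)
Definition crosscut_map (k : fieldType) (r : rel P) : 'End(chain k P) :=
  (pushforward k (least_elt r) \o pushforward k atoms_below
     \o subdivision k P)%VF.

Lemma covered_unionE X a l : covered_by l a ->
  covered_union X a = X l :|: other_union X a l.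
Proof. by move=> la; rewrite /covered_union (bigD1 l). Qed.

Lemma bigcup_complex (Q : pred P) X : (forall a, is_complex (X a)) ->
  is_complex (\bigcup_(a | Q a) X a).
Proof.
move=> Xc s t /bigcupP[a Qa sX] ts; apply/bigcupP; exists a => //.
exact: Xc sX ts.
Qed.

Lemma order_complexP (Q : {set P}) : is_complex (order_complex Q).
Proof.
move=> s t; rewrite !inE => /andP[sQ /forall_inP sc] ts.
rewrite (subset_trans ts sQ); apply/forall_inP => x xt; apply/forall_inP => y yt.
by have /forall_inP := sc x (subsetP ts x xt); apply; apply: (subsetP ts).
Qed.

Lemma phiE (k : fieldType) X n a l
    (z : subvs_of (cycles k n.+1 (covered_union X a))) (c c' : chain k P) :
    (forall b, is_complex (X b)) -> covered_by l a ->
    X l :&: other_union X a l \subset covered_union X l ->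
    vsval z = c + c' -> c \in chains k n.+1 (X l) ->
    c' \in chains k n.+1 (other_union X a l) ->
  phi l (hclass z) = hclass (vsproj (cycles k n (covered_union X l)) (boundary k P c)).
Proof.
move=> Xc la sub def_z cX c'X; have defK := covered_unionE X la.
have Oc : is_complex (other_union X a l) by apply: bigcup_complex.
rewrite /phi (connectingE (Xc l) Oc defK def_z cX c'X) hmap_incl // vsprojK //.
exact: (boundary_part (Xc l) Oc (subvsP z) def_z cX c'X).
Qed.

Lemma Gcomplex_complex a : is_complex (Gcomplex a).
Proof. by move=> s t; rewrite !powersetE => sS ts; apply: subset_trans sS. Qed.

Lemma Dcomplex_complex a : is_complex (Dcomplex a).
Proof. exact: order_complexP. Qed.

Lemma crosscut_map_chains (k : fieldType) (r : rel P) n a :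
  {in atoms &, total r} -> {in atoms & &, transitive r} ->
  {in chains k n (Dcomplex a),
    forall c, crosscut_map k r c \in chains k n (Gcomplex a)}.
Proof.
move=> rtot rtr c cD; rewrite !comp_lfunE.
set Sa := [set x in atoms | (x <= a)%O].
apply: (pushforward_chains (K := powerset (powerset Sa :\ set0))).
  move=> F; rewrite /Gcomplex !powersetE => FS; apply/subsetP => _ /imsetP[A AF ->].
  have /setD1P[A0] := subsetP FS A AF; rewrite powersetE => AS.
  rewrite /least_elt; case: pickP => [x /andP[xA _]|noA] /=.
    exact: (subsetP AS).
  have {A0} [x0 x0A] : exists x, x \in A by apply/set0Pn.
  have At : {subset A <= atoms} by move=> y /(subsetP AS); rewrite inE => /andP[].
  suff [x xA /allP xmin] : exists2 x, x \in A & all (r x) (enum A).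
    have /negP[] := negbT (noA x); rewrite xA /=; apply/forall_inP => y yA.
    by apply: xmin; rewrite mem_enum.
  have : {subset enum A <= A} by move=> y; rewrite mem_enum.
  elim: (enum A) => [_|y l IH lA]; first by exists x0.
  have yA : y \in A by rewrite lA ?mem_head.
  have [z zA zl] : exists2 z, z \in A & all (r z) l.
    by apply: IH => z zl; rewrite lA // inE zl orbT.
  have [rzy|] := boolP (r z y); first by exists z => //=; rewrite rzy.
  have /orP[->//|ryz] := rtot z y (At _ zA) (At _ yA) => _.
  exists y => //=; apply/andP; split.
    by have := rtot y y (At _ yA) (At _ yA); rewrite orbb.
  apply/allP => t tl; apply: (rtr z) (allP zl t tl) => //; try exact: At.
  by apply/At/lA; rewrite inE tl orbT.
apply: (pushforward_chains (K := powerset (Dcomplex a :\ set0))).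
  move=> F; rewrite !powersetE => FD; apply/subsetP => _ /imsetP[s sF ->].
  have := subsetP FD s sF; rewrite !inE => /and3P[/set0Pn[x0 x0s] sD sch].
  have inD y : y \in s -> (\bot < y <= a)%O by move/(subsetP sD); rewrite inE.
  apply/andP; split; last first.
    apply/subsetP => x; rewrite !inE => /andP[-> /forall_inP /(_ x0 x0s) xx0].
    by have /andP[_] := inD _ x0s; apply: le_trans xx0.
  have [m ms mmin] : exists2 m, m \in s & {in s, forall y, (m <= y)%O}.
    pose m := [arg min_(m < x0 in s) #|[set z : P | (z <= m)%O]|].
    exists m; rewrite /m; case: arg_minnP => // {}m ms mP y ys.
    have /forall_inP/(_ m ms)/forall_inP/(_ y ys) := sch.
    case/orP => // ym; have := mP y ys; rewrite leqNgt.
    case: (eqVneq y m) => [->//|yNm]; case/negP; apply/proper_card/properP.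
    split; first by apply/subsetP => z; rewrite !inE => /le_trans; apply.
    exists m; rewrite !inE //; apply: contra yNm => my.
    by rewrite eq_le ym my.
  have /andP[m0 _] := inD m ms.
  pose x := [arg min_(x < m | (\bot < x <= m)%O) #|[set z : P | (z <= x)%O]|].
  apply/set0Pn; exists x; rewrite /x.
  case: arg_minnP => [|{}x /andP[xpos xm] xP]; first by rewrite m0 lexx.
  rewrite !inE /covered_by xpos /=; apply/andP; split; last first.
    by apply/forall_inP => y ys; apply: le_trans xm (mmin y ys).
  apply/forallP => z; apply/negP => /andP[z0 zx].
  have := xP z; rewrite z0 (le_trans (ltW zx) xm) => /(_ isT).
  rewrite leqNgt => /negP; apply; apply/proper_card/properP.
  split; first by apply/subsetP => y; rewrite !inE => /le_trans/(_ (ltW zx)).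
  by exists x; rewrite !inE ?lexx //; apply/negP => /(lt_le_trans zx); rewrite ltxx.
exact: subdivision_chains (@Dcomplex_complex a) _ cD.
Qed.

Lemma Dcomplex_sub a : Dcomplex a \subset order_complex (~: [set \bot%O]).
Proof.
apply/subsetP => s; rewrite !inE => /andP[sD ->]; rewrite andbT.
by apply: subset_trans sD _; apply/subsetP => x; rewrite !inE lt0x => /andP[].
Qed.

Lemma Gcomplex_sub a : a != \bot%O ->
  Gcomplex a \subset crosscut_complex (~: [set \bot%O]) atoms.
Proof.
move=> a0; apply/subsetP => A; rewrite powersetE inE => AS; apply/andP; split.
  by apply: subset_trans AS _; apply/subsetP => x; rewrite inE => /andP[].
apply/exists_inP; exists a; first by rewrite !inE.
by apply/orP; left; apply/forall_inP => x /(subsetP AS); rewrite inE => /andP[].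
Qed.

End PosetHomology.

Arguments phi {d P} k X n a l x.

(* Main.v *)
From HB Require Import structures.
Require Import Defs.
From mathcomp Require Import all_boot all_order all_algebra.
Set Implicit Arguments.
Unset Strict Implicit.
Unset Printing Implicit Defensive.
Import Order.Theory GRing.Theory.
Local Open Scope ring_scope.

(** The map f carries D_y into G_y for every y.  Conversely a set A of atoms in
    Γ_a has a least upper bound below a, by the crosscut condition, so the
    method of acyclic carriers produces a chain map g from Γ_a to Δ_a carried
    by A |-> D_(lub A).  Now g f and the identity are both carried by
    s |-> D_(lub s) on Δ_a, and f g and the identity by A |-> G_(lub A) on Γ_a.
    These carriers are cones, so g is a homotopy inverse of f.  The square
    commutes because f is a chain map respecting the two parts of the
    Mayer-Vietoris decomposition. *)

(** * Linear maps of chain spaces, determined by their values on simplices *)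

Section Hom.
Variables (k : fieldType).
Implicit Types V W : finType.

Lemma sub_lfunE V W (f g : 'Hom(chain k V, chain k W)) c :
  (f - g)%VF c = f c - g c.
Proof. by rewrite add_lfunE opp_lfunE. Qed.

Lemma eq_hom V W (f g : 'Hom(chain k V, chain k W)) :
  (forall s, f (simplex k s) = g (simplex k s)) -> f =1 g.
Proof.
move=> fg c; rewrite [c]chain_sum !linear_sum; apply: eq_bigr => s _.
by rewrite !linearZ /= fg.
Qed.

Lemma eq_hom_chains V W n (K : {set {set V}}) (f g : 'Hom(chain k V, chain k W)) :
  (forall s, s \in K -> #|s| = n -> f (simplex k s) = g (simplex k s)) ->
  {in chains k n K, f =1 g}.
Proof.
move=> fg c cK; apply/eqP; rewrite -subr_eq0 -memv0.
have -> : f c - g c = (f - g)%VF c by rewrite sub_lfunE.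
apply: (chains_simplex_ind (K := K)) cK => s sK sn.
by rewrite sub_lfunE fg // subrr mem0v.
Qed.

Lemma chainsS V n (K L : {set {set V}}) :
  K \subset L -> (chains k n K <= chains k n L)%VS.
Proof.
move=> KL; apply/subvP => c /chainsP cK; apply/chainsP => s /cK[sK ->].
by rewrite (subsetP KL).
Qed.

(** Both the chain map and the homotopy of the acyclic carrier method are defined this way, the
    value on [s] depending on the values on the boundary of [s]. No linearity of [step] is required,
    because it is evaluated only at simplices and the result is extended linearly. *)
Lemma hom_rec V W (c0 : chain k W) (step : {set V} -> chain k W -> chain k W) :
  exists2 G : 'Hom(chain k V, chain k W), G (simplex k set0) = c0 &
    forall s, s != set0 -> G (simplex k s) = step s (G (boundary k V (simplex k s))).
Proof.
(* The argument [n] is fuel. Faces in the boundary of [s] have one vertex fewer than [s], so fuel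
   [#|s|] is exactly enough, and one step down it is again the cardinality of the face. *)
pose gen := fix gen n : 'Hom(chain k V, chain k W) := linfun (extend (fun s =>
  if n is m.+1 then step s (gen m (boundary k V (simplex k s))) else c0)).
have genE n s : gen n (simplex k s) =
  if n is m.+1 then step s (gen m (boundary k V (simplex k s))) else c0.
  by case: n => [|n]; rewrite lfunE /= extend_simplex.
pose G : 'Hom(chain k V, chain k W) :=
  linfun (extend (fun s => gen #|s| (simplex k s))).
have GE s : G (simplex k s) = gen #|s| (simplex k s).
  by rewrite lfunE /= extend_simplex.
exists G => [|s s0]; first by rewrite GE cards0 genE.
rewrite GE; case def_n: #|s| => [|n]; first by rewrite (cards0_eq def_n) eqxx in s0.
rewrite genE; congr step; rewrite boundary_simplex !linear_sum.
apply: eq_bigr => v vs; rewrite !linearZ /= GE; congr (_ *: gen _ _).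
by apply/eqP; rewrite -eqSS -def_n (cardsD1 v s) vs.
Qed.

End Hom.

(** * The cone operator and its signs *)

Section Cone.
Variables (k : fieldType).
Implicit Types V W : finType.

(* The oriented simplex [v_0, ..., v_p] |-> [x, v_0, ..., v_p]. *)
Definition cone V (x : V) : 'End(chain k V) :=
  linfun (extend (fun s : {set V} => if x \in s then 0 else
    (-1) ^+ index x (enum (x |: s)) *: simplex k (x |: s))).

Lemma cone_simplex V (x : V) (s : {set V}) : cone x (simplex k s) =
  if x \in s then 0 else (-1) ^+ index x (enum (x |: s)) *: simplex k (x |: s).
Proof. by rewrite lfunE /= extend_simplex. Qed.

Lemma simplex_cone V (x : V) (s : {set V}) : x \in s ->
  simplex k s = (-1) ^+ index x (enum s) *: cone x (simplex k (s :\ x)).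
Proof.
by move=> xs; rewrite cone_simplex setD11 setD1K // scalerA -expr2 sqrr_sign scale1r.
Qed.

(** Deleting the earlier of two vertices shifts the later one by one place and not conversely, so
    the two orders of deletion carry opposite signs. *)
Lemma odd_index_enum_D1 V (t : {set V}) x y : x \in t -> y \in t -> x != y ->
  odd (index x (enum t)) (+) odd (index y (enum (t :\ x))) =
  ~~ (odd (index y (enum t)) (+) odd (index x (enum (t :\ y)))).
Proof.
move=> xt yt xy; have ey := index_enum_D1 xt yt xy.
have := index_enum_D1 yt xt; rewrite eq_sym => /(_ xy) ex.
have: index x (enum t) != index y (enum t).
  apply: contra xy => /eqP e.
  by rewrite -(nth_index x (s := enum t) (x := x)) ?mem_enum // e nth_index ?mem_enum.
rewrite -[in LHS]ex -[in RHS]ey !oddD neq_ltn.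
case/orP=> lt; rewrite lt [(index _ _ < _)%N]ltnNge (ltnW lt) /=;
  by case: (odd _); case: (odd _).
Qed.

(** The cone contracts the augmented chain complex. If [x] lies in [s], the cone on [s] vanishes and
    only the face [s :\ x] has a nonzero cone, which gives back [s]. Otherwise the face opposite [x]
    is [s], and the other faces match by the sign rule [odd_index_enum_D1]. *)
Lemma boundary_cone V (x : V) c :
  boundary k V (cone x c) = c - cone x (boundary k V c).
Proof.
suff: (boundary k V \o cone x)%VF =1 (\1 - (cone x \o boundary k V))%VF.
  by move/(_ c); rewrite sub_lfunE !comp_lfunE id_lfunE.
apply: eq_hom => s; rewrite sub_lfunE !comp_lfunE id_lfunE.
rewrite boundary_simplex linear_sum cone_simplex; case: ifPn => xs.
  rewrite linear0 (bigD1 x) //= big1 => [|v /andP[vs vx]].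
    by rewrite linearZ /= -simplex_cone // addr0 subrr.
  by rewrite linearZ /= cone_simplex !inE eq_sym vx xs scaler0.
set t := x |: s; have tx : t :\ x = s by rewrite setU1K.
rewrite linearZ /= boundary_simplex (bigD1 x) ?setU11 //= tx.
rewrite scalerDr scalerA -expr2 sqrr_sign scale1r; congr (_ + _).
rewrite scaler_sumr -sumrN; apply: eq_big => [v|v].
  by rewrite /t !inE; case: eqVneq => [->|]; rewrite ?(negPf xs) ?andbT ?andbF.
case/andP; rewrite /t => vt vx; have xv : x != v by rewrite eq_sym.
have vs : v \in s by move: vt; rewrite !inE (negPf vx).
rewrite [cone x _]linearZ /= cone_simplex !inE (negPf xv) (negPf xs) /=.
have -> : x |: (s :\ v) = t :\ v.
  by apply/setP => y; rewrite !inE; case: (eqVneq y x) => // ->; rewrite xv.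
rewrite !scalerA -scaleNr -!exprD -/t; congr (_ *: _).
have xt : x \in t by rewrite setU11.
rewrite -signr_odd -[X in _ = - X]signr_odd !oddD.
have := odd_index_enum_D1 xt vt xv; rewrite tx.
by do 4!case: (odd _) => //=; rewrite // !expr0 expr1 ?opprK.
Qed.

Lemma cone_cone V (x y : V) c : cone x (cone y c) = - cone y (cone x c).
Proof.
suff: (cone x \o cone y)%VF =1 (0 - (cone y \o cone x))%VF.
  by move/(_ c); rewrite sub_lfunE !comp_lfunE zero_lfunE sub0r.
apply: eq_hom => s; rewrite sub_lfunE !comp_lfunE zero_lfunE sub0r.
rewrite !cone_simplex.
have [->|xy] := eqVneq x y.
  case: ifP; first by rewrite linear0 oppr0.
  by rewrite linearZ /= cone_simplex setU11 scaler0 oppr0.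
case: ifPn => ys; case: ifPn => xs; rewrite ?linear0 ?oppr0 //.
- by rewrite linearZ /= cone_simplex !inE ys orbT scaler0 oppr0.
- by rewrite linearZ /= cone_simplex !inE xs orbT scaler0.
rewrite [cone x _]linearZ [cone y _]linearZ /= !cone_simplex !inE (negPf xs) (negPf ys).
rewrite [y == x]eq_sym (negPf xy) /= !scalerA.
rewrite [y |: (x |: s)]setUCA -scaleNr -!exprD; congr (_ *: _).
set t := x |: (y |: s).
have ty : t :\ y = x |: s by rewrite /t setUCA setU1K // !inE eq_sym (negPf xy).
have tx : t :\ x = y |: s by rewrite /t setU1K // !inE (negPf xy).
rewrite -signr_odd -[X in _ = - X]signr_odd !oddD.
have := @odd_index_enum_D1 _ t x y; rewrite tx ty !inE !eqxx orbT => /(_ isT isT xy).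
by do 4!case: (odd _) => //=; rewrite // !expr0 expr1 ?opprK.
Qed.

(** This links the two sign conventions: positions in [enum s], used by [boundary] and [cone], and
    comparisons of ranks, used by [inversions]. *)
Lemma index_filter_count V (l : seq V) (p : pred V) x : uniq l -> x \in l -> p x ->
  index x (filter p l) = count (fun y => index y l < index x l)%N (filter p l).
Proof.
elim: l => //= z l IH /andP[zl ul]; rewrite inE; case: (eqVneq x z) => [-> _ pz|xz /= xl px].
  by rewrite pz /= !eqxx /= (@eq_count _ _ pred0) ?count_pred0 // => y; case: eqP.
have e : count (fun y => (if z == y then 0 else (index y l).+1) < (index x l).+1)%N
   (filter p l) = count (fun y => index y l < index x l)%N (filter p l).
  apply: eq_in_count => y; rewrite mem_filter => /andP[_ yl].
  by case: eqP zl => [->|]; rewrite ?yl ?ltnS.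
case: ifP => pz /=; last by rewrite IH // e.
by rewrite eqxx eq_sym (negPf xz) /= e IH.
Qed.

Lemma index_enum_rank V (x : V) : index x (enum V) = enum_rank x.
Proof.
by rewrite -{1}(nth_enum_rank x x) index_uniq ?enum_uniq // -cardE.
Qed.

Lemma index_enum_count V (s : {set V}) x : x \in s ->
  index x (enum s) = count (fun y => enum_rank y < enum_rank x)%N (enum s).
Proof.
move=> xs; have es : enum s = filter (mem s) (enum V).
  by rewrite /enum_mem -filter_predI; apply: eq_filter => y; rewrite /= andbT.
rewrite {1}es index_filter_count ?enum_uniq ?mem_enum // -es.
by apply: eq_count => y; rewrite !index_enum_rank.
Qed.

(** Prepending [x] adds as many inversions as there are smaller vertices in [l], which is the
    position of [x] in the enlarged face. Oriented simplices thereby become iterated cones over the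
    empty simplex, and reordering reduces to [cone_cone]. *)
Lemma osimplex_cons V x (l : seq V) : osimplex k (x :: l) = cone x (osimplex k l).
Proof.
rewrite /osimplex /=; case: ifPn; last first.
  case: ifP => ul; last by rewrite linear0.
  by rewrite andbT negbK => xl; rewrite linearZ /= cone_simplex inE xl scaler0.
case/andP=> xl ul; rewrite ul linearZ /= cone_simplex inE (negPf xl) scalerA.
have -> : x |: [set:: l] = [set:: x :: l].
  by apply/setP => y; rewrite !inE.
rewrite exprD mulrC; congr (_ * _ ^+ _ *: _).
rewrite index_enum_count ?inE ?eqxx //.
have /permP -> : perm_eq (enum [set:: x :: l]) (x :: l).
  apply: uniq_perm; rewrite ?enum_uniq //= ?xl // => y.
  by rewrite mem_enum inE.
by rewrite /= ltnn.
Qed.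

Lemma osimplex_nil V : osimplex k [::] = simplex k (set0 : {set V}).
Proof.
have set_nil : [set:: [::]] = set0 :> {set V} by apply/setP => x; rewrite !inE.
by rewrite /osimplex /= scale1r set_nil.
Qed.

Lemma osimplex_middle V x (l1 l2 : seq V) :
  osimplex k (l1 ++ x :: l2) = (-1) ^+ size l1 *: cone x (osimplex k (l1 ++ l2)).
Proof.
elim: l1 => [|y l1 IH] /=; first by rewrite scale1r osimplex_cons.
by rewrite !osimplex_cons IH linearZ /= cone_cone scalerN exprS mulN1r scaleNr.
Qed.

(** * Simplicial maps induce chain maps *)

Lemma pushforward_simplex V W (g : V -> W) s :
  pushforward k g (simplex k s) = osimplex k (map g (enum s)).
Proof. by rewrite lfunE /= extend_simplex. Qed.

Lemma pushforward0 V W (g : V -> W) :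
  pushforward k g (simplex k set0) = simplex k set0.
Proof. by rewrite pushforward_simplex enum_set0 osimplex_nil. Qed.

Lemma enum_U1 V (s : {set V}) x : x \notin s ->
  exists l1 l2, [/\ enum s = l1 ++ l2, enum (x |: s) = l1 ++ x :: l2
                 & index x (enum (x |: s)) = size l1].
Proof.
move=> xs; have es : enum s = rem x (enum (x |: s)).
  rewrite rem_filter ?enum_uniq // /enum_mem -filter_predI; apply: eq_filter => y.
  by rewrite /= !inE; case: (eqVneq y x) => // ->; rewrite (negPf xs).
have xe : x \in enum (x |: s) by rewrite mem_enum setU11.
exists (take (index x (enum (x |: s))) (enum (x |: s))).
exists (drop (index x (enum (x |: s))).+1 (enum (x |: s))).
rewrite es remE size_takel ?index_size //; split => //.
by rewrite -{1}(cat_take_drop (index x (enum (x |: s))) (enum _)) (drop_nth x)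
  ?index_mem // nth_index.
Qed.

(** Inserting [x] into the sorted list of [s] costs the same sign before and after applying [g], and
    the two signs cancel. When [x] already lies in [s], both sides vanish, the right one because
    [g x] is repeated. *)
Lemma pushforward_cone V W (g : V -> W) x c :
  pushforward k g (cone x c) = cone (g x) (pushforward k g c).
Proof.
suff: (pushforward k g \o cone x)%VF =1 (cone (g x) \o pushforward k g)%VF.
  by move/(_ c); rewrite !comp_lfunE.
apply: eq_hom => s; rewrite !comp_lfunE cone_simplex [in RHS]pushforward_simplex.
rewrite -osimplex_cons; case: ifPn => xs.
  rewrite linear0 /osimplex /= map_f //= mem_enum //.
have [l1 [l2 [-> es ->]]] := enum_U1 xs.
rewrite linearZ /= pushforward_simplex es !map_cat /= osimplex_middle.
by rewrite scalerA size_map -expr2 sqrr_sign scale1r osimplex_cons.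
Qed.

Lemma boundary_simplex0 V : boundary k V (simplex k set0) = 0.
Proof. by rewrite boundary_simplex big1 // => v; rewrite inE. Qed.

Lemma simplex_ind V (Q : chain k V -> Prop) : Q (simplex k set0) ->
  (forall x c, Q c -> Q (cone x c)) -> (forall a c, Q c -> Q (a *: c)) ->
  forall s, Q (simplex k s).
Proof.
move=> Q0 QC QZ s; have [n] := ubnP #|s|; elim: n s => // n IH s.
have [->|/set0Pn[x xs] sn] := eqVneq s set0; first by [].
rewrite (simplex_cone xs); apply/QZ/QC/IH.
by move: sn; rewrite (cardsD1 x s) xs.
Qed.

Lemma boundary_pushforward V W (g : V -> W) c :
  boundary k W (pushforward k g c) = pushforward k g (boundary k V c).
Proof.
suff: (boundary k W \o pushforward k g)%VF =1 (pushforward k g \o boundary k V)%VF.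
  by move/(_ c); rewrite !comp_lfunE.
apply: eq_hom => s; rewrite !comp_lfunE.
apply: (simplex_ind (Q := fun e =>
  boundary k W (pushforward k g e) = pushforward k g (boundary k V e))).
- by rewrite pushforward0 !boundary_simplex0 linear0.
- move=> x e IH.
  by rewrite pushforward_cone !boundary_cone IH linearB /= pushforward_cone.
- by move=> a e IH; rewrite !linearZ /= IH.
Qed.

(** * Barycentric subdivision is a chain map *)

Definition flag V (w : seq V) : seq {set V} :=
  [seq [set:: take j.+1 w] | j <- iota 0 (size w)].

Lemma flag_rcons V (w : seq V) v : flag (rcons w v) = rcons (flag w) [set:: rcons w v].
Proof.
rewrite /flag size_rcons -addn1 iotaD map_cat cats1; congr rcons.
  apply/eq_in_map => j; rewrite mem_iota => /andP[_ jw]; congr [set:: _].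
  by rewrite -cats1 takel_cat.
by rewrite take_oversize // size_rcons.
Qed.

Lemma inversions_rcons V (w : seq V) v : inversions (rcons w v) =
  (inversions w + count (fun y => enum_rank v < enum_rank y) w)%N.
Proof.
elim: w => //= x w ->; rewrite -cats1 count_cat /= addn0.
by rewrite -!addnA; congr (_ + _)%N; rewrite addnCA.
Qed.

Lemma subdivision_simplex V (s : {set V}) : subdivision k V (simplex k s) =
  \sum_(w <- permutations (enum s)) (-1) ^+ inversions w *: osimplex k (flag w).
Proof. by rewrite lfunE /= extend_simplex. Qed.

Lemma perm_rcons_enum V (s : {set V}) w v : v \in s ->
  perm_eq (rcons w v) (enum s) = perm_eq w (enum (s :\ v)).
Proof.
move=> vs; rewrite perm_rcons -[RHS](perm_cons v).
suff /permPr-> : perm_eq (enum s) (v :: enum (s :\ v)) by [].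
apply: uniq_perm; rewrite /= ?mem_enum ?setD11 ?enum_uniq // => y.
by rewrite inE !mem_enum !inE; case: eqVneq => // ->.
Qed.

(** Permutations are sorted by their last entry. The empty set is excluded since its only
    permutation has none. *)
Lemma big_permutations V (R : nmodType) (s : {set V}) (F : seq V -> R) : s != set0 ->
  \sum_(w <- permutations (enum s)) F w =
  \sum_(v in s) \sum_(w <- permutations (enum (s :\ v))) F (rcons w v).
Proof.
move=> s0; rewrite -[RHS]big_enum /=.
rewrite -(big_allpairs_dep (h := fun v w => rcons w v)
  (r2 := fun v => permutations (enum (s :\ v)))).
apply/perm_big/uniq_perm; rewrite ?permutations_uniq //.
  apply: allpairs_uniq_dep => [|v _|[v w] [v' w'] _ _ /=].
  - exact: enum_uniq.
  - exact: permutations_uniq.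
  - by move/rcons_inj => [-> ->].
move=> w; rewrite mem_permutations; apply/idP/allpairsPdep.
  case/lastP: w => [|w v] ws.
    by move: (perm_size ws) s0; rewrite -cardE -cards_eq0 /= => <-.
  have vs : v \in enum s by rewrite -(perm_mem ws) mem_rcons mem_head.
  exists v, w; split=> //; rewrite mem_permutations -perm_rcons_enum //.
  by rewrite -mem_enum.
case=> v [w' [vs]]; rewrite mem_permutations => w's ->.
by rewrite perm_rcons_enum // -mem_enum.
Qed.

(** Every flag of a permutation of [s] ends in [s], the barycenter of the face. Removing it leaves a
    flag of the facet that omits the last entry of the permutation. *)
Lemma subdivision_cone V (s : {set V}) : s != set0 ->
  subdivision k V (simplex k s) =
  cone s (subdivision k V (boundary k V (simplex k s))).
Proof.
move=> s0; rewrite subdivision_simplex big_permutations // boundary_simplex !linear_sum.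
apply: eq_bigr => v vs; rewrite !linearZ /= subdivision_simplex.
rewrite linear_sum scaler_sumr; apply: eq_big_seq => w.
rewrite mem_permutations => ws; rewrite linearZ /= scalerA.
have ws' : perm_eq (rcons w v) (enum s) by rewrite perm_rcons_enum.
rewrite flag_rcons.
have -> : [set:: rcons w v] = s.
  by apply/setP => x; rewrite inE (perm_mem ws') mem_enum.
rewrite -(cats1 (flag w)) osimplex_middle cats0 scalerA; congr (_ *: _).
rewrite inversions_rcons -!exprD -signr_odd -[RHS]signr_odd; congr (_ ^+ _).
(* Moving [s] to the front of the flag costs one sign per entry of [w]. Entries above [v] cancel the
   inversions created by appending [v]; those below [v] number [index v (enum s)], the sign in the
   boundary. *)
have : size (flag w) = (count (fun y => enum_rank v < enum_rank y)%N w + index v (enum s))%N.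
  rewrite size_map size_iota index_enum_count // -(permP ws') -cats1 count_cat /= ltnn addn0.
  rewrite addn0 -(count_predC (fun y => enum_rank v < enum_rank y)%N w); congr (_ + _)%N.
  apply: eq_in_count => y; rewrite (perm_mem ws) mem_enum !inE => /andP[yv _] /=.
  rewrite -leqNgt leq_eqVlt -[_ == _ :> nat]/(enum_rank y == enum_rank v).
  by rewrite (inj_eq enum_rank_inj) (negPf yv).
move->; rewrite !oddD.
by do 3!case: (odd _).
Qed.

Lemma subdivision0 V : subdivision k V (simplex k set0) = simplex k set0.
Proof.
by rewrite subdivision_simplex enum_set0 big_seq1 /= scale1r osimplex_nil.
Qed.

Lemma boundary_subdivision V c :
  boundary k _ (subdivision k V c) = subdivision k V (boundary k V c).
Proof.
suff: (boundary k _ \o subdivision k V)%VF =1 (subdivision k V \o boundary k V)%VF.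
  by move/(_ c); rewrite !comp_lfunE.
apply: eq_hom => s; rewrite !comp_lfunE.
have [n] := ubnP #|s|; elim: n s => // n IH s.
have [->|s0 sn] := eqVneq s set0.
  by rewrite subdivision0 !boundary_simplex0 linear0.
rewrite subdivision_cone // boundary_cone.
(* By [boundary_cone] the error term is the cone over this chain, which is zero once the induction
   hypothesis turns it into the subdivision of a double boundary. *)
suff -> : boundary k _ (subdivision k V (boundary k V (simplex k s))) =
    subdivision k V (boundary k V (boundary k V (simplex k s))).
  by rewrite boundary_boundary !linear0 addr0.
rewrite boundary_simplex !linear_sum; apply: eq_bigr => v vs.
rewrite !linearZ /= IH //; by move: sn; rewrite (cardsD1 v s) vs.
Qed.

Lemma cone_chains V n (K L : {set {set V}}) (x : V) :
  (forall s, s \in K -> x |: s \in L) ->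
  {in chains k n K, forall c, cone x c \in chains k n.+1 L}.
Proof.
move=> KL; apply: chains_simplex_ind => s sK sn; rewrite cone_simplex.
case: ifPn => xs; first exact: mem0v.
by apply/rpredZ/simplex_chains; rewrite ?KL // cardsU1 xs sn.
Qed.

End Cone.

(* Acyclic carriers: each [Phi s] with s nonempty is a cone with apex
   [apex s], which gives an explicit contraction. *)
Section Carriers.
Variables (k : fieldType) (V W : finType) (K : {set {set V}}).
Variables (Phi : {set V} -> {set {set W}}) (apex : {set V} -> W).
Hypothesis Kc : is_complex K.
Hypothesis Phi_mono : forall s t : {set V}, t \in K -> s \subset t -> Phi s \subset Phi t.
Hypothesis Phi_cone : forall (s : {set V}) t,
  s \in K -> s != set0 -> t \in Phi s -> apex s |: t \in Phi s.

Let dK s : s \in K -> forall n, #|s| = n.+1 ->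
  boundary k V (simplex k s) \in chains k n (K :&: powerset s).
Proof.
move=> sK n sn; apply: boundary_chains; last first.
  by apply: simplex_chains; rewrite // !inE sK subxx.
move=> t u; rewrite !inE => /andP[tK ts] ut.
by rewrite (subset_trans ut ts) (Kc tK ut).
Qed.

(** The value on [s] is the cone with apex [apex s] over the value on the boundary of [s]. That
    value is a cycle by induction, so the boundary of its cone is the cycle itself. *)
Lemma carrier_map : (set0 \in K -> set0 \in Phi set0) ->
  exists2 G : 'Hom(chain k V, chain k W), G (simplex k set0) = simplex k set0 &
    forall s, s \in K ->
    boundary k W (G (simplex k s)) = G (boundary k V (simplex k s)) /\
    G (simplex k s) \in chains k #|s| (Phi s).
Proof.
move=> Phi0.
have [G G0 GS] := hom_rec (simplex k set0 : chain k W) (fun s c => cone k (apex s) c).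
exists G => // s sK.
have [n] := ubnP #|s|; elim: n s sK => // n IH s sK.
have [s0|s0] := eqVneq s set0.
  rewrite s0 in sK *.
  by rewrite G0 !boundary_simplex0 linear0 simplex_chains ?cards0 ?Phi0.
case def_m : #|s| => [|m] sn; first by rewrite (cards0_eq def_m) eqxx in s0.
(* The induction hypothesis, extended linearly to chains on subsets of [s]; the vertex count [m]
   rules out [s] itself. *)
have IHc c : c \in chains k m (K :&: powerset s) ->
    boundary k W (G c) = G (boundary k V c) /\ G c \in chains k m (Phi s).
  move=> cK; split; last first.
    apply: (chains_simplex_ind (K := K :&: powerset s)) cK => t.
    rewrite !inE => /andP[tK ts] tm; rewrite -tm.
    apply: subvP (chainsS _ _ (Phi_mono sK ts)) _ _.
    by apply IH; rewrite ?tm.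
  rewrite -!comp_lfunE; apply: (eq_hom_chains (K := K :&: powerset s)) cK => t.
  rewrite !inE !comp_lfunE => /andP[tK ts] tm.
  by apply IH; rewrite ?tm.
have [dG Gd] := IHc _ (dK sK def_m).
rewrite GS // boundary_cone dG boundary_boundary !linear0 addr0; split => //.
apply: cone_chains Gd => t; exact: Phi_cone.
Qed.

(** Applied to the difference [h] of two chain maps with a common carrier. The recursion builds [H]
    with $h=\partial H+H\partial$, so that $h(z)=\partial H(z)$ on a cycle. It starts from [H] zero
    on the empty simplex, where [h] vanishes; no cone structure is assumed there, as the carrier of
    the empty face may be just {∅}. *)
Lemma carrier_homotopy (h : 'Hom(chain k V, chain k W)) n (L : {set {set W}}) :
    h (simplex k set0) = 0 ->
    (forall s, s \in K ->
      boundary k W (h (simplex k s)) = h (boundary k V (simplex k s)) /\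
      h (simplex k s) \in chains k #|s| (Phi s)) ->
    (forall s, s \in K -> Phi s \subset L) ->
  {in cycles k n K, forall z, h z \in boundaries k n L}.
Proof.
move=> h0 hP PhiL.
have [H H0 HS] := hom_rec (0 : chain k W)
  (fun s c => cone k (apex s) (h (simplex k s) - c)).
have HP s : s \in K ->
    boundary k W (H (simplex k s)) =
      h (simplex k s) - H (boundary k V (simplex k s)) /\
    H (simplex k s) \in chains k #|s|.+1 (Phi s).
  have [m] := ubnP #|s|; elim: m s => // m IH s sm sK.
  have [s0|s0] := eqVneq s set0.
    rewrite s0 in sK *.
    by rewrite H0 boundary_simplex0 !linear0 h0 addr0 mem0v.
  case def_p : #|s| => [|p]; first by rewrite (cards0_eq def_p) eqxx in s0.
  rewrite def_p in sm.
  have IHc c : c \in chains k p (K :&: powerset s) ->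
      boundary k W (H c) = h c - H (boundary k V c) /\
      H c \in chains k p.+1 (Phi s).
    move=> cK; split; last first.
      apply: (chains_simplex_ind (K := K :&: powerset s)) cK => t.
      rewrite !inE => /andP[tK ts] tm; rewrite -tm.
      apply: subvP (chainsS _ _ (Phi_mono sK ts)) _ _.
      by apply IH; rewrite ?tm.
    suff: (boundary k W \o H)%VF c = (h - (H \o boundary k V))%VF c.
      by rewrite sub_lfunE !comp_lfunE.
    apply: (eq_hom_chains (K := K :&: powerset s)) cK => t.
    rewrite !inE sub_lfunE !comp_lfunE => /andP[tK ts] tm.
    by apply IH; rewrite ?tm.
  have [dH Hd] := IHc _ (dK sK def_p); have [dh hs] := hP s sK.
  rewrite HS // boundary_cone linearB /= dh dH boundary_boundary linear0 subr0.
  rewrite subrr linear0 subr0; split => //.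
  apply: cone_chains (_ : _ \in chains k _ (Phi s)) => [t|].
    exact: Phi_cone.
  by rewrite rpredB // -def_p.
move=> z; rewrite memv_cap memv_ker => /andP[zK /eqP dz].
have -> : h z = boundary k W (H z).
  suff -> : boundary k W (H z) = h z - H (boundary k V z).
    by rewrite dz linear0 subr0.
  suff: (boundary k W \o H)%VF z = (h - (H \o boundary k V))%VF z.
    by rewrite sub_lfunE !comp_lfunE.
  apply: (eq_hom_chains (K := K)) zK => t tK _.
  by rewrite sub_lfunE !comp_lfunE; apply HP.
apply: memv_img; apply: (chains_simplex_ind (K := K)) zK => t tK tn.
apply: subvP (chainsS _ _ (PhiL _ tK)) _ _.
by rewrite -tn; apply HP.
Qed.

End Carriers.

(** * Chain maps between complexes and isomorphisms in homology *)

Section ChainMaps.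
Variable k : fieldType.
Implicit Types V W : finType.

(** Commutation with the boundary is asked on chains of [K] only, since a map built by [carrier_map]
    is controlled only there. *)
Definition chain_map V W (K : {set {set V}}) (L : {set {set W}})
    (f : 'Hom(chain k V, chain k W)) :=
  forall n, {in chains k n K, forall c,
    f c \in chains k n L /\ boundary k W (f c) = f (boundary k V c)}.

Lemma chain_map_cycles V W (K : {set {set V}}) (L : {set {set W}}) f n :
  chain_map K L f -> {in cycles k n K, forall c, f c \in cycles k n L}.
Proof.
move=> fP c; rewrite !memv_cap !memv_ker => /andP[/fP[-> ->] /eqP->].
by rewrite linear0 eqxx.
Qed.

Lemma chain_map_boundaries V W (K : {set {set V}}) (L : {set {set W}}) f n :
  chain_map K L f -> {in boundaries k n K, forall c, f c \in boundaries k n L}.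
Proof. by move=> fP _ /memv_imgP[e /fP[fe de] ->]; rewrite -de; apply: memv_img. Qed.

End ChainMaps.

Section HomologyIso.
Variables (k : fieldType) (V W : finType).
Variables (K : {set {set V}}) (L : {set {set W}}).

Lemma homology_iso (f : 'Hom(chain k V, chain k W)) (g : 'Hom(chain k W, chain k V)) n :
    chain_map K L f -> chain_map L K g ->
    {in cycles k n K, forall z, g (f z) - z \in boundaries k n K} ->
    {in cycles k n L, forall z, f (g z) - z \in boundaries k n L} ->
  exists F : {linear homology k n K -> homology k n L},
    induces f F /\ bijective F.
Proof.
move=> fP gP gf fg.
have fZ := @chain_map_cycles _ _ _ _ _ _ n fP.
have fB := @chain_map_boundaries _ _ _ _ _ _ n fP.
have gZ := @chain_map_cycles _ _ _ _ _ _ n gP.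
have gB := @chain_map_boundaries _ _ _ _ _ _ n gP.
pose F0 : homology k n K -> homology k n L := hmap f.
pose Fmix := GRing.isSemilinear.Build k (homology k n K) (homology k n L) _ F0
  (GRing.semilinear_linear (hmap_linear fZ fB)).
pose F : {linear homology k n K -> homology k n L} := HB.pack F0 Fmix.
exists F; split.
  move=> z; exists (vsproj (cycles k n L) (f (vsval z))); last exact: hmapE.
  by rewrite vsprojK // fZ // subvsP.
exists (hmap g); elim/hclassW=> z; rewrite /= /F0.
  rewrite (hmapE fZ fB) (hmapE gZ gB); apply/eqP; rewrite hclass_eq.
  have fz := fZ _ (subvsP z); have gfz := gZ _ fz.
  by rewrite !vsprojK //; apply: gf (subvsP z).
rewrite (hmapE gZ gB) (hmapE fZ fB); apply/eqP; rewrite hclass_eq.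
have gz := gZ _ (subvsP z); have fgz := fZ _ gz.
by rewrite !vsprojK //; apply: fg (subvsP z).
Qed.

End HomologyIso.

(** * Least upper bounds, and the families D and G *)

Section Posets.
Variables (d : Order.disp_t) (P : finBPOrderType d).
Implicit Types (x y a b l : P) (s A : {set P}).

Lemma exists_covered x y : (x < y)%O -> exists2 l, covered_by l y & (x <= l)%O.
Proof.
(* The size of the principal down-set is strictly increasing, so maximizing it over the interval
   gives a maximal element. *)
move=> xy; pose l := [arg max_(l > x | (x <= l < y)%O) #|[set z : P | (z <= l)%O]|].
exists l; rewrite /l; case: arg_maxnP; rewrite ?lexx // => {}l /andP[xl ly] lP //.
rewrite /covered_by ly; apply/forallP => z; apply/negP => /andP[lz zy].
have := lP z; rewrite zy (le_trans xl (ltW lz)) => /(_ isT).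
rewrite /geq /= leqNgt => /negP; apply; apply/proper_card/properP.
split; first by apply/subsetP => t; rewrite !inE => /le_trans/(_ (ltW lz)).
by exists z; rewrite !inE ?lexx //; apply/negP => /(lt_le_trans lz); rewrite ltxx.
Qed.

(** Unlike the joins of the crosscut condition, this is taken in all of P, so that the empty face
    has the least upper bound [\bot]. *)
Definition is_lub A x := upper_bound A x && [forall y, upper_bound A y ==> (x <= y)%O].

Definition lub A : P := odflt \bot%O [pick x | is_lub A x].

Lemma lubP A x : is_lub A x -> is_lub A (lub A).
Proof. by move=> Ax; rewrite /lub; case: pickP => [//|/(_ x)]; rewrite Ax. Qed.

Lemma is_lubP A x : reflect
  (upper_bound A x /\ forall y, upper_bound A y -> (x <= y)%O) (is_lub A x).
Proof.
apply: (iffP andP) => -[Ax Ay]; split=> //.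
  by move=> y yA; have /forallP/(_ y)/implyP := Ay; apply.
by apply/forallP => y; apply/implyP; apply: Ay.
Qed.

Lemma upper_boundS s A x : s \subset A -> upper_bound A x -> upper_bound s x.
Proof.
move=> /subsetP sA /forall_inP Ax; apply/forall_inP => y ys; apply: Ax; exact: sA.
Qed.

Lemma upper_bound_le A x y : (x <= y)%O -> upper_bound A x -> upper_bound A y.
Proof.
by move=> xy /forall_inP Ax; apply/forall_inP => z zA; apply: le_trans (Ax z zA) xy.
Qed.

Lemma upper_bound0 x : upper_bound set0 x.
Proof. by apply/forall_inP => y; rewrite inE. Qed.

Lemma is_lub0 : is_lub (set0 : {set P}) \bot%O.
Proof. by apply/is_lubP; split=> [|y _]; rewrite ?upper_bound0 ?le0x. Qed.

Lemma chain_lub s (Q : {set P}) : s \in order_complex Q -> is_lub s (lub s).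
Proof.
rewrite inE => /andP[_ /forall_inP sch].
have [->|/set0Pn[x xs]] := eqVneq s set0; first exact: lubP is_lub0.
pose m := [arg max_(m > x in s) #|[set z : P | (z <= m)%O]|].
apply: (@lubP _ m); rewrite /m; case: arg_maxnP => // {}m ms mP.
apply/is_lubP; split=> [|y /forall_inP]; last by apply.
apply/forall_inP => y ys; have /forall_inP/(_ m ms) := sch y ys.
case/orP => // my; have := mP y ys; rewrite /geq /= leqNgt.
case: (eqVneq y m) => [->//|yNm]; case/negP; apply/proper_card/properP.
split; first by apply/subsetP => z; rewrite !inE => /le_trans; apply.
by exists y; rewrite !inE //; apply: contra yNm => ym; rewrite eq_le ym my.
Qed.

Lemma atom_gt0 x : x \in atoms P -> (\bot < x)%O.
Proof. by rewrite inE => /andP[]. Qed.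

Lemma le_atom x y : x \in atoms P -> (\bot < y)%O -> (y <= x)%O -> y = x.
Proof.
rewrite inE => /andP[_ /forallP/(_ y)]; rewrite negb_and => /orP[/negbTE->//|].
by move=> yx _ ylex; apply/eqP; apply: contraNT yx => yNx; rewrite lt_neqAle yNx.
Qed.

(** The crosscut condition may supply a meet instead of a join. A meet is nonzero and below every
    atom of [A], hence equal to each of them; then [A] is a singleton and its meet is also its
    join. *)
Lemma atoms_lub A x : is_crosscut (~: [set \bot%O]) (atoms P) ->
  A \subset atoms P -> upper_bound A x -> is_lub A (lub A).
Proof.
move=> [_ _ _ cc] Aat Ax.
have [->|A0] := eqVneq A set0; first exact: lubP is_lub0.
have /set0Pn[t tA] := A0; have t_at := subsetP Aat t tA.
have gt0 y : upper_bound A y -> y \in ~: [set \bot%O].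
  move=> /forall_inP/(_ t tA) ty; rewrite !inE -lt0x.
  exact: lt_le_trans (atom_gt0 t_at) ty.
have [|y [[yQ Ay yP]|[yQ Ay _]]] := cc A A0 Aat.
- by apply/exists_inP; exists x; rewrite ?gt0 // Ax.
- apply: (@lubP _ y); apply/is_lubP; split=> // z Az; apply: yP => //; exact: gt0.
have eqy z : z \in A -> y = z.
  move=> zA; apply: le_atom; first exact: (subsetP Aat).
    by move: yQ; rewrite !inE lt0x.
  by move/forall_inP: Ay => /(_ z zA).
apply: (@lubP _ y); apply/is_lubP; split=> [|z /forall_inP].
  by apply/forall_inP => z /eqy ->.
by move/(_ t tA); rewrite -(eqy t tA).
Qed.

Lemma DcomplexE s x :
  (s \in Dcomplex x) = (s \in order_complex (~: [set \bot%O])) && upper_bound s x.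
Proof.
rewrite !inE andbAC; congr (_ && _); apply/subsetP/andP.
  move=> sx; split; first by apply/subsetP => y /sx; rewrite !inE lt0x => /andP[].
  by apply/forall_inP => y /sx; rewrite inE => /andP[].
case=> /subsetP sQ /forall_inP sx y ys; have := sQ y ys.
by rewrite !inE lt0x => ->; apply: sx.
Qed.

Lemma GcomplexE s x : (s \in Gcomplex x) = (s \subset atoms P) && upper_bound s x.
Proof.
rewrite powersetE; apply/subsetP/andP.
  move=> sx; split; first by apply/subsetP => y /sx; rewrite !inE => /andP[].
  by apply/forall_inP => y /sx; rewrite inE => /andP[].
by case=> /subsetP sQ /forall_inP sx y ys; rewrite inE (sQ y ys) sx.
Qed.

Lemma DcomplexS x y : (x <= y)%O -> Dcomplex x \subset Dcomplex y.
Proof.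
move=> xy; apply/subsetP => s; rewrite !DcomplexE => /andP[-> /=].
exact: upper_bound_le.
Qed.

Lemma GcomplexS x y : (x <= y)%O -> Gcomplex x \subset Gcomplex y.
Proof.
move=> xy; apply/subsetP => s; rewrite !GcomplexE => /andP[-> /=].
exact: upper_bound_le.
Qed.

(** For a monotone family the union over the elements covered by [a] contains every member with
    index below [a], which makes carriers indexed by least upper bounds fit inside it. *)
Lemma covered_unionS (X : P -> {set {set P}}) a x :
  {homo X : y z / (y <= z)%O >-> y \subset z} -> (x < a)%O ->
  X x \subset covered_union X a.
Proof.
move=> XS xa; have [l la xl] := exists_covered xa.
by apply: subset_trans (XS _ _ xl) _; apply: bigcup_sup.
Qed.

Lemma covered_union_complex (X : P -> {set {set P}}) a :
  (forall x, is_complex (X x)) -> is_complex (covered_union X a).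
Proof. exact: bigcup_complex. Qed.

Definition lub_closed (X : P -> {set {set P}}) :=
  forall x s, s \in X x ->
    [/\ is_lub s (lub s), (lub s <= x)%O & s \in X (lub s)].

Lemma Dcomplex_lub : lub_closed (@Dcomplex d P).
Proof.
move=> x s; rewrite !DcomplexE => /andP[sQ sx].
have s_lub := chain_lub sQ; have [s1 s2] := is_lubP _ _ s_lub.
by rewrite s_lub s2 // sQ s1.
Qed.

Lemma Gcomplex_lub : is_crosscut (~: [set \bot%O]) (atoms P) ->
  lub_closed (@Gcomplex d P).
Proof.
move=> cc x s; rewrite !GcomplexE => /andP[sQ sx].
have s_lub := atoms_lub cc sQ sx; have [s1 s2] := is_lubP _ _ s_lub.
by rewrite s_lub s2 // sQ s1.
Qed.

Lemma covered_union_lub (X : P -> {set {set P}}) a s : lub_closed X ->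
  s \in covered_union X a -> [/\ is_lub s (lub s), (lub s < a)%O & s \in X (lub s)].
Proof.
move=> XP /bigcupP[l /andP[la _] /XP[? sl ?]]; split=> //.
exact: le_lt_trans sl la.
Qed.

Lemma lubS s A : is_lub s (lub s) -> is_lub A (lub A) -> s \subset A -> (lub s <= lub A)%O.
Proof.
by move=> /is_lubP[_ sP] /is_lubP[AA _] sA; apply: sP; apply: upper_boundS sA AA.
Qed.

(** A face in the overlap has its least upper bound below both [l] and another element [b] covered
    by [a]. Equality with [l] would put [l] strictly below [b], against the covering relation, so
    the bound is strictly below [l]. *)
Lemma overlap_sub (X : P -> {set {set P}}) a l :
    {homo X : y z / (y <= z)%O >-> y \subset z} -> lub_closed X ->
    covered_by l a ->
  X l :&: other_union X a l \subset covered_union X l.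
Proof.
move=> XS XP /andP[la /forallP lcov]; apply/subsetP => s /setIP[sl].
case/bigcupP=> b /andP[/andP[ba /forallP bcov] bl] sb.
have [_ sl' sX] := XP _ _ sl; have [_ sb' _] := XP _ _ sb.
apply: (subsetP (covered_unionS XS _)) sX.
rewrite lt_neqAle sl' andbT; apply: contra (lcov b) => /eqP e.
by rewrite e in sb'; rewrite ba lt_neqAle eq_sym bl sb'.
Qed.

End Posets.

(** * The crosscut map: homotopy inverse and compatibility with φ *)

Section CrosscutMap.
Variables (k : fieldType) (d : Order.disp_t) (P : finBPOrderType d) (r : rel P).

Lemma crosscut_map0 : crosscut_map k r (simplex k set0) = simplex k set0.
Proof. by rewrite !comp_lfunE subdivision0 !pushforward0. Qed.

Lemma boundary_crosscut_map c :
  boundary k P (crosscut_map k r c) = crosscut_map k r (boundary k P c).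
Proof. by rewrite !comp_lfunE !boundary_pushforward boundary_subdivision. Qed.

Hypothesis r_total : {in atoms P &, total r}.
Hypothesis r_trans : {in atoms P & &, transitive r}.
Hypothesis S_crosscut : is_crosscut (~: [set \bot%O]) (atoms P).

Let f := crosscut_map k r.
Let DS := @DcomplexS d P.
Let GS := @GcomplexS d P.
Let DL := @Dcomplex_lub d P.
Let GL := Gcomplex_lub S_crosscut.

Lemma crosscut_map_covered (a : P) : chain_map (Delta a) (Gamma a) f.
Proof.
move=> n c cD; split; last exact: boundary_crosscut_map.
apply: (chains_simplex_ind (K := Delta a)) cD => s sD sn.
have [_ sa sDs] := covered_union_lub DL sD.
apply: subvP (chainsS _ _ (covered_unionS GS sa)) _ _.
by apply: crosscut_map_chains => //; apply: simplex_chains.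
Qed.

Lemma crosscut_homotopy_inverse (a : P) :
  exists2 g : 'End(chain k P), chain_map (Gamma a) (Delta a) g &
    forall n,
      {in cycles k n (Delta a), forall z, g (f z) - z \in boundaries k n (Delta a)} /\
      {in cycles k n (Gamma a), forall z, f (g z) - z \in boundaries k n (Gamma a)}.
Proof.
have Dc : is_complex (Delta a) by apply/covered_union_complex/Dcomplex_complex.
have Gc : is_complex (Gamma a) by apply/covered_union_complex/Gcomplex_complex.
(* The apex [lub s] is comparable to everything in its down-set, and it is a vertex because a
   nonempty [s] avoiding [\bot] forces it above [\bot]. *)
have Dcone (s t : {set P}) : is_lub s (lub s) -> s \subset ~: [set \bot%O] -> s != set0 ->
    t \in Dcomplex (lub s) -> lub s |: t \in Dcomplex (lub s).
  case/is_lubP=> /forall_inP sub _ sQ /set0Pn[x xs].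
  have s0 : (\bot < lub s)%O.
    by apply: lt_le_trans (sub x xs); have := subsetP sQ x xs; rewrite !inE lt0x.
  rewrite !inE => /andP[tD tch]; rewrite subUset sub1set !inE s0 lexx tD /=.
  have tl y : y \in t -> (y <= lub s)%O by move/(subsetP tD); rewrite inE => /andP[].
  apply/forall_inP => y /setU1P[->|yt]; apply/forall_inP => z /setU1P[->|zt].
  - exact: comparablexx.
  - by rewrite /Order.comparable tl ?orbT.
  - by rewrite /Order.comparable tl.
  - by have /forall_inP/(_ y yt)/forall_inP/(_ z zt) := tch.
have DlubS (s t : {set P}) : t \in Delta a -> s \subset t -> Dcomplex (lub s) \subset Dcomplex (lub t).
  move=> tD st; have [tl _ _] := covered_union_lub DL tD.
  by have [sl _ _] := covered_union_lub DL (Dc _ _ tD st); apply/DS/lubS.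
have DlubG (s t : {set P}) : t \in Gamma a -> s \subset t -> Dcomplex (lub s) \subset Dcomplex (lub t).
  move=> tG st; have [tl _ _] := covered_union_lub GL tG.
  by have [sl _ _] := covered_union_lub GL (Gc _ _ tG st); apply/DS/lubS.
have GlubG (s t : {set P}) : t \in Gamma a -> s \subset t -> Gcomplex (lub s) \subset Gcomplex (lub t).
  move=> tG st; have [tl _ _] := covered_union_lub GL tG.
  by have [sl _ _] := covered_union_lub GL (Gc _ _ tG st); apply/GS/lubS.
have Gat (s : {set P}) : s \in Gamma a -> s \subset atoms P.
  by case/bigcupP=> l _; rewrite GcomplexE => /andP[].
have atQ : atoms P \subset ~: [set \bot%O] by case: S_crosscut.
have DQ (s : {set P}) : s \in Delta a -> s \subset ~: [set \bot%O].
  by case/bigcupP=> l _; rewrite DcomplexE inE => /andP[/andP[]].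
have [||g g0 gP] := carrier_map k Gc DlubG (apex := @lub d P).
- move=> s t sG; apply: Dcone; first by have [] := covered_union_lub GL sG.
  exact: subset_trans (Gat _ sG) atQ.
- move=> _; rewrite DcomplexE upper_bound0 andbT inE sub0set.
  by apply/forall_inP => x; rewrite inE.
have gchain : chain_map (Gamma a) (Delta a) g.
  move=> n c cG; split.
    apply: (chains_simplex_ind (K := Gamma a)) cG => s sG <-.
    have [_ sa _] := covered_union_lub GL sG.
    apply: subvP (chainsS _ _ (covered_unionS DS sa)) _ _.
    by have [] := gP s sG.
  rewrite -!comp_lfunE; apply: (eq_hom_chains (K := Gamma a)) cG => s sG _.
  by rewrite !comp_lfunE; have [] := gP s sG.
have fchain := @crosscut_map_covered a.
(* The restriction to [x] below [a] ensures that faces of [Gcomplex x] lie in [Gamma a], where the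
   carrier of [g] is known. *)
have gD x n : (x < a)%O ->
    {in chains k n (Gcomplex x), forall c, g c \in chains k n (Dcomplex x)}.
  move=> xa; apply: chains_simplex_ind => s sG <-.
  have sGa := subsetP (covered_unionS GS xa) s sG.
  have [_ sx _] := GL sG.
  apply: subvP (chainsS _ _ (DS sx)) _ _.
  by have [] := gP s sGa.
have fG x n : {in chains k n (Dcomplex x), forall c, f c \in chains k n (Gcomplex x)}.
  exact: crosscut_map_chains.
have gfE c : ((g \o f) - \1)%VF c = g (f c) - c.
  by rewrite sub_lfunE id_lfunE comp_lfunE.
have fgE c : ((f \o g) - \1)%VF c = f (g c) - c.
  by rewrite sub_lfunE id_lfunE comp_lfunE.
exists g => // n; split=> z zZ.
  rewrite -gfE.
  apply: (carrier_homotopy Dc DlubS (apex := @lub d P)) zZ => [s t sD|||].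
  - by apply: Dcone; [have [] := covered_union_lub DL sD | apply: DQ].
  - by rewrite gfE crosscut_map0 g0 subrr.
  - move=> s sD; rewrite !gfE.
    have [_ sa sX] := covered_union_lub DL sD.
    have sc : simplex k s \in chains k #|s| (Dcomplex (lub s)) by apply: simplex_chains.
    have sc' : simplex k s \in chains k #|s| (Delta a) by apply: simplex_chains.
    have [fsc fsd] := fchain _ _ sc'; have [_ gd] := gchain _ _ fsc.
    by rewrite linearB /= gd fsd rpredB // gD // fG.
  - by move=> s sD; have [_ sa _] := covered_union_lub DL sD; apply: covered_unionS.
rewrite -fgE.
(* Here [lub s] need not be an atom, but [Gcomplex (lub s)] is a full simplex, so any element of [s]
   serves as apex. The default is reached only for empty [s]. *)
apply: (carrier_homotopy Gc GlubG (apex := fun s => odflt \bot%O [pick x in s])) zZ.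
- move=> s t sG s0; have [/is_lubP[/forall_inP sub _] _ _] := covered_union_lub GL sG.
  case: pickP => [x xs|s1]; last by have /set0Pn[x] := s0; rewrite s1.
  rewrite !GcomplexE => /andP[ta /forall_inP tl].
  rewrite subUset sub1set ta (subsetP (Gat _ sG)) //=.
  by apply/forall_inP => y /setU1P[->|/tl //]; apply: sub.
- by rewrite fgE g0 crosscut_map0 subrr.
- move=> s sG; rewrite !fgE.
  have [_ sa sX] := covered_union_lub GL sG.
  have sc : simplex k s \in chains k #|s| (Gcomplex (lub s)) by apply: simplex_chains.
  have sc' : simplex k s \in chains k #|s| (Gamma a) by apply: simplex_chains.
  have [gsc gsd] := gchain _ _ sc'; have [_ fd] := fchain _ _ gsc.
  by rewrite linearB /= fd gsd rpredB // fG // gD.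
- by move=> s sG; have [_ sa _] := covered_union_lub GL sG; apply: covered_unionS.
Qed.

Lemma crosscut_map_homology (a : P) n :
  exists F : {linear homology k n (Delta a) -> homology k n (Gamma a)},
    induces f F /\ bijective F.
Proof.
have [g gP gfg] := crosscut_homotopy_inverse a; have [gf fg] := gfg n.
exact: homology_iso (crosscut_map_covered (a := a)) gP gf fg.
Qed.

(** If $z=c+c'$ splits a cycle along the cover on the D side, then $f(z)=f(c)+f(c')$ splits its
    image on the G side. The two classes are thus represented by $f(\partial c)$ and $\partial
    f(c)$, which are equal as chains. *)
Lemma phi_natural (a b : P) n (F : homology k n.+1 (Delta a) -> homology k n.+1 (Gamma a))
    (G : homology k n (Delta b) -> homology k n (Gamma b)) :
  covered_by b a -> induces f F -> induces f G ->
  forall x, G (phi k (@Dcomplex d P) n a b x) = phi k (@Gcomplex d P) n a b (F x).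
Proof.
move=> ba FP GP; elim/hclassW=> z.
have Dc := @Dcomplex_complex d P; have Gc := @Gcomplex_complex d P.
have Oc X : (forall x, is_complex (X x)) -> is_complex (other_union X a b).
  by move=> Xc; apply: bigcup_complex.
have defD := covered_unionE (@Dcomplex d P) ba.
have zC := subvP (capvSl _ _) _ (subvsP z).
set c := restrict k (Dcomplex b) (vsval z); set c' := vsval z - c.
have def_z : vsval z = c + c' by rewrite subrKC.
have cD : c \in chains k n.+1 (Dcomplex b) by apply: restrict_chains zC.
have c'D : c' \in chains k n.+1 (other_union (@Dcomplex d P) a b).
  exact: (restrictC_chains defD zC).
have subD := overlap_sub DS DL ba; have subG := overlap_sub GS GL ba.
rewrite (phiE Dc ba subD def_z cD c'D).
have [w def_w ->] := FP z; rewrite def_z linearD in def_w.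
have fcG := crosscut_map_chains r_total r_trans cD.
have fc'G : f c' \in chains k n.+1 (other_union (@Gcomplex d P) a b).
  apply: (chains_simplex_ind (K := other_union (@Dcomplex d P) a b)) c'D => s.
  case/bigcupP=> l la sl sn.
  apply: subvP (chainsS _ _ (bigcup_sup (F := @Gcomplex d P) l la)) _ _.
  by apply: crosscut_map_chains => //; apply: simplex_chains.
rewrite (phiE Gc ba subG def_w fcG fc'G).
have [w' def_w' ->] := GP (vsproj (cycles k n (covered_union (@Dcomplex d P) b)) (boundary k P c)).
congr hclass; apply: val_inj; rewrite /=.
(* Needed so that [vsproj] returns this chain unchanged: it is a cycle on the overlap, which [subD]
   places inside [Delta b]. *)
have dc : boundary k P c \in cycles k n (Delta b).
  have := boundary_part (Dc b) (Oc _ Dc) _ def_z cD c'D.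
  move=> H; apply: subvP (capvS (chainsS _ _ subD) (subvv _)) _ _.
  by apply: H; apply: subvsP z.
rewrite vsprojK // in def_w'.
by rewrite boundary_crosscut_map -def_w' vsprojK ?subvsP.
Qed.

End CrosscutMap.

Theorem proposition3p1 (k : fieldType) (d : Order.disp_t)
    (P : finBPOrderType d) (r : rel P)
    (r_total : {in atoms P &, total r})
    (r_anti : {in atoms P &, antisymmetric r})
    (r_trans : {in atoms P & &, transitive r})
    (S_crosscut : is_crosscut (~: [set \bot%O]) (atoms P))
    (a b : P) (ba : covered_by b a) (i : nat) (i_ge1 : (1 <= i)%N) :
  exists (F : {linear homology k i.+1 (Delta a) -> homology k i.+1 (Gamma a)})
         (G : {linear homology k i (Delta b) -> homology k i (Gamma b)}),
    [/\ induces (crosscut_map k r) F /\ bijective F,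
        induces (crosscut_map k r) G /\ bijective G
      & forall x : homology k i.+1 (Delta a),
          G (phi k (@Dcomplex d P) i a b x) = phi k (@Gcomplex d P) i a b (F x)].
Proof.
have [F [FP Fbij]] := crosscut_map_homology k r_total r_trans S_crosscut a i.+1.
have [G [GP Gbij]] := crosscut_map_homology k r_total r_trans S_crosscut b i.
by exists F, G; split=> //; apply: (phi_natural r_total r_trans).
Qed.
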